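(* Let $\Gamma$ be a nonempty index set, let $X=\ell^1(\Gamma)$, and let $Y$ be a real normed space. Suppose that $f:X\rightarrow Y$ is a surjective phase-isometry. Then $f$ is phase equivalent to a linear isometry.
   Context: A mapping $f: X\to Y$ between real normed spaces is a phase-isometry if $\{\|f(x)+f(y)\|, \|f(x)-f(y)\|\}=\{\|x+y\|, \|x-y\|\}$ (equality of unordered pairs) for all $x,y\in X$. No continuity or linearity is assumed. A mapping $f:X\to Y$ is phase equivalent to a linear isometry if there exists a function $\varepsilon: X\to\{-1,1\}$ such that the map $x\mapsto \varepsilon(x)f(x)$ is a linear isometry. $\ell^1(\Gamma)$ is the real space of families $x=(x_\gamma)_{\gamma\in\Gamma}$ of real numbers with $\|x\|=\sum_{\gamma\in\Gamma}|x_\gamma|<\infty$; $\Gamma$ is allowed to be uncountable. *)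

(* Defs.v *)
From HB Require Import structures.
From mathcomp Require Import all_boot all_order all_algebra.
From mathcomp Require Import all_classical all_reals all_analysis.

Set Implicit Arguments.
Unset Strict Implicit.
Unset Printing Implicit Defensive.

Import Order.TTheory GRing.Theory Num.Theory.
Import numFieldNormedType.Exports.

Local Open Scope classical_set_scope.
Local Open Scope ring_scope.

Section l1_space.
Variables (R : realType) (Gamma : choiceType).
Implicit Types x y : Gamma -> R.

Definition l1_pred : {pred Gamma -> R} :=
  fun x => summable [set: Gamma] (EFin \o x).

(* As subtype of the function space, [l1] carries the pointwise operations. *)
Record l1 := L1 { l1_fun :> Gamma -> R; _ : l1_fun \in l1_pred }.

HB.instance Definition _ := [isSub for l1_fun].
HB.instance Definition _ := [Choice of l1 by <:].

Definition l1_enorm x : \bar R := (\esum_(i in [set: Gamma]) `|x i|%:E)%E.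

Lemma l1_predE x : (x \in l1_pred) = (l1_enorm x < +oo)%E.
Proof. by []. Qed.

Lemma l1_enorm_ge0 x : (0 <= l1_enorm x)%E.
Proof. by apply: esum_ge0 => i _; rewrite lee_fin. Qed.

Lemma l1_enormD x y : (l1_enorm (x + y)%R <= l1_enorm x + l1_enorm y)%E.
Proof.
rewrite /l1_enorm -esumD; [|by move=> *; rewrite lee_fin..].
by apply: le_esum => i _; rewrite -EFinD lee_fin ler_normD.
Qed.

Lemma l1_enormZ_le (a : R) x : (l1_enorm (a *: x)%R <= `|a|%:E * l1_enorm x)%E.
Proof.
apply: ge_ereal_sup => _ [A [finA _] <-].
under eq_fsbigr do rewrite normrM EFinM.
rewrite -ge0_mule_fsumr; last by move=> i; rewrite lee_fin.
by rewrite lee_wpmul2l ?lee_fin// ereal_sup_ubound//; exists A.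
Qed.

Lemma l1_submod_closed : submod_closed l1_pred.
Proof.
split.
  by rewrite l1_predE /l1_enorm esum1// => i _; rewrite normr0.
move=> a x y; rewrite !l1_predE => xfin yfin.
apply: (le_lt_trans (l1_enormD _ _)); apply: lte_add_pinfty => //.
apply: (le_lt_trans (l1_enormZ_le _ _)).
rewrite -ge0_fin_numE ?mule_ge0 ?l1_enorm_ge0//.
by rewrite fin_numM// ge0_fin_numE ?l1_enorm_ge0.
Qed.

HB.instance Definition _ :=
  GRing.isSubmodClosed.Build _ _ l1_pred l1_submod_closed.
HB.instance Definition _ := [SubChoice_isSubLmodule of l1 by <:].

Definition l1_norm (x : l1) : R := fine (l1_enorm x).

Lemma l1_enorm_fin (x : l1) : l1_enorm x \is a fin_num.
Proof. by rewrite ge0_fin_numE ?l1_enorm_ge0// -l1_predE (valP x). Qed.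

Lemma l1_normD (x y : l1) : l1_norm (x + y) <= l1_norm x + l1_norm y.
Proof. by rewrite -lee_fin EFinD !fineK ?l1_enorm_fin// l1_enormD. Qed.

Lemma l1_norm_eq0 (x : l1) : l1_norm x = 0 -> x = 0.
Proof.
move=> x0; apply/val_inj/funext => i; apply/normr0_eq0/le_anti/andP; split=> //.
rewrite -lee_fin -[X in (_ <= X%:E)%E]x0 fineK ?l1_enorm_fin//.
by apply: esum_ge; exists [set i]; rewrite ?fsbig_set1.
Qed.

Lemma l1_normZ (a : R) (x : l1) : l1_norm (a *: x) = `|a| * l1_norm x.
Proof.
have leZ (b : R) (y : l1) : l1_norm (b *: y) <= `|b| * l1_norm y.
  by rewrite -lee_fin EFinM !fineK ?l1_enorm_fin// l1_enormZ_le.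
apply/le_anti; rewrite leZ/=.
have [->|a0] := eqVneq a 0.
  by rewrite normr0 mul0r fine_ge0// l1_enorm_ge0.
rewrite -ler_pdivlMl ?normr_gt0// -normfV.
by rewrite -[X in l1_norm X <= _](scalerK a0) leZ.
Qed.

HB.instance Definition _ :=
  Lmodule_isNormed.Build R l1 l1_normD l1_normZ l1_norm_eq0.

Lemma l1_normE (x : l1) :
  `|x|%:E = (\esum_(i in [set: Gamma]) `|x i|%:E)%E.
Proof. by rewrite [LHS]fineK ?l1_enorm_fin. Qed.

End l1_space.

Section phase_isometry.
Variables (R : realType) (X Y : normedModType R).

(* Sets with at most two elements are equal exactly when the corresponding
   unordered pairs are: [set a; a] = [set c; d] forces c = d = a. *)
Definition phase_isometry (f : X -> Y) : Prop :=
  forall x y : X,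
    [set `|f x + f y|; `|f x - f y|] = [set `|x + y|; `|x - y|].

Definition linear_isometry (g : X -> Y) : Prop :=
  linear g /\ forall x y : X, `|g x - g y| = `|x - y|.

Definition phase_equivalent_to_linear_isometry (f : X -> Y) : Prop :=
  exists eps : X -> R,
    (forall x, eps x = -1 \/ eps x = 1) /\
    linear_isometry (fun x => eps x *: f x).

End phase_isometry.

(* Main.v *)
Require Import Defs.
From mathcomp Require Import all_boot all_order all_algebra.
From mathcomp Require Import all_classical all_reals all_analysis.
From mathcomp Require Import ring lra.
Import Order.TTheory GRing.Theory Num.Theory.
Import numFieldNormedType.Exports.
Local Open Scope classical_set_scope.
Local Open Scope ring_scope.

(** Write [u g = f (e g)] for the images of the unit vectors. Coordinates can be
   read off in [Y] from the norm alone: for [s] large,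
   [(`|y + s u g| - `|y - s u g|) / 2] does not depend on [s] and its absolute
   value at [y = f x] is [`|x g|]. Calling this number [c g y], one gets
   [c g (y + t u d) = c g y + t (g == d)]; since [c g] is 1-Lipschitz and the
   finite combinations of the [u d] are dense, [c g] is linear. The phase
   condition for [x] and [e g + e d] shows that
   [c g (f x) * c d (f x) = r g d * (x g * x d)] with a sign [r g d] independent
   of [x], which splits as [th g * th d]; hence [c g (f x) = e x * (th g * x g)]
   with a sign [e x] independent of [g], and [e x f x] is linear in [x]. *)

(** * Coordinates and norms in [l1] *)

Section l1_coordinates.
Context {R : realType} {Gamma : choiceType}.
Implicit Types (x y w : l1 R Gamma) (g d : Gamma) (t s : R).

Lemma l1D x y g : (x + y) g = x g + y g. Proof. by []. Qed.

Lemma l1N x g : (- x) g = - x g. Proof. by []. Qed.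

Lemma l1Z t x g : (t *: x) g = t * x g. Proof. by []. Qed.

Lemma l1P x y : (forall g, x g = y g) -> x = y.
Proof. by move=> xy; apply/val_inj/funext. Qed.

Lemma indic1_l1 g : (fun i => (i == g)%:R : R) \in @l1_pred R Gamma.
Proof.
rewrite l1_predE /l1_enorm.
rewrite (eq_esum (b := fun i => if i \in [set g] then 1%:E else 0%E)).
  by rewrite -esum_mkcond esum_set1 ?lee_fin// ltry.
move=> i _; have [->|ig] := eqVneq i g; first by rewrite normr1 mem_set.
by rewrite normr0 memNset//= => /eqP; rewrite (negPf ig).
Qed.

Definition l1_unit g : l1 R Gamma := L1 (indic1_l1 g).

Lemma l1_unitE g i : l1_unit g i = (i == g)%:R. Proof. by []. Qed.

Lemma norm_l1_eq1 g w x : (forall i, i != g -> `|w i| = `|x i|) ->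
  `|w| - `|w g| = `|x| - `|x g|.
Proof.
have normE y : `|y|%:E =
    (`|y g|%:E + \esum_(i in ~` [set g]) `|y i|%:E)%E.
  rewrite l1_normE (esumID [set g]) ?setTI; last by move=> i _; rewrite lee_fin.
  by rewrite esum_set1 ?lee_fin.
move=> wx; apply: EFin_inj; rewrite !EFinB !normE.
rewrite (eq_esum (b := fun i => `|x i|%:E)).
  by rewrite ![(_ + (\esum_(i in _) _))%E]addeC !addeK.
by move=> i /eqP ig; rewrite wx.
Qed.

Lemma norm_l1_eq g x w : (forall i, `|w i| = `|x i|) -> `|w| = `|x|.
Proof.
move=> wx.
have h : `|w| - `|w g| = `|x| - `|x g| by apply: norm_l1_eq1 => i _; apply: wx.
by rewrite wx in h; lra.
Qed.

Lemma norm_l1D_unit x t g : `|x + t *: l1_unit g| = `|x| - `|x g| + `|x g + t|.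
Proof.
have h : `|x + t *: l1_unit g| - `|(x + t *: l1_unit g) g| = `|x| - `|x g|.
  apply: norm_l1_eq1 => i ig.
  by rewrite l1D l1Z l1_unitE (negPf ig) mulr0 addr0.
by rewrite l1D l1Z l1_unitE eqxx mulr1 in h; lra.
Qed.

Lemma norm_l1_unit g : `|l1_unit g| = 1.
Proof.
have := norm_l1D_unit 0 1 g.
have -> : (0 : l1 R Gamma) g = 0 by [].
by rewrite !add0r scale1r !normr0 subr0 add0r normr1.
Qed.

Lemma norm_l1_coord x g : `|x g| <= `|x|.
Proof.
have := norm_l1D_unit x (- x g) g; rewrite subrr normr0 addr0.
by have := normr_ge0 (x + - x g *: l1_unit g); lra.
Qed.

Lemma norm_l1_eq2 g d w x : g != d ->
  (forall i, i != g -> i != d -> `|w i| = `|x i|) ->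
  `|w| - `|w g| - `|w d| = `|x| - `|x g| - `|x d|.
Proof.
(* [v] is [w] with its coordinate at [g] replaced by that of [x], which splits the comparison into
   two changes of a single coordinate. *)
move=> gd wx; pose v := w + (x g - w g) *: l1_unit g.
have vg : v g = x g by rewrite l1D l1Z l1_unitE eqxx mulr1 addrC subrK.
have vn i : i != g -> v i = w i.
  by move=> ig; rewrite l1D l1Z l1_unitE (negPf ig) mulr0 addr0.
have vE : `|v| - `|v g| = `|w| - `|w g| by apply: norm_l1_eq1 => i /vn ->.
have : `|v| - `|v d| = `|x| - `|x d|.
  apply: norm_l1_eq1 => i id; have [->|ig] := eqVneq i g; first by rewrite vg.
  by rewrite vn// wx.
have -> : v d = w d by rewrite vn// eq_sym.
by rewrite vg in vE; lra.
Qed.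

(** The coordinates of [x] in [A] are put back into [w] one at a time, each adding its absolute
    value to the norm. *)
Lemma norm_l1_vanish g0 (A : seq Gamma) w x :
    uniq A -> {in A, forall i, w i = 0} ->
    (forall i, i \notin A -> `|w i| = `|x i|) ->
  `|w| + \sum_(i <- A) `|x i| = `|x|.
Proof.
elim: A w => [|g A IH] w /=.
  move=> _ _ wx; rewrite big_nil addr0.
  by apply: (norm_l1_eq g0) => i; apply: wx.
case/andP=> gA uA w0 wx; rewrite big_cons.
have wg : w g = 0 by apply: w0; rewrite mem_head.
rewrite -(IH (w + x g *: l1_unit g))//.
- by rewrite norm_l1D_unit wg normr0 subr0 add0r addrA.
- move=> i iA; rewrite l1D l1Z l1_unitE w0 ?inE ?iA ?orbT// add0r.
  by case: eqP => [ig|]; rewrite ?mulr0//; move: gA; rewrite -ig iA.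
- move=> i iA; rewrite l1D l1Z l1_unitE; have [->|ig] := eqVneq i g.
    by rewrite wg mulr1 add0r.
  by rewrite mulr0 addr0 wx// inE (negPf ig).
Qed.

Lemma norm_l1_partial_sum x (e : R) : 0 < e ->
  exists2 A : seq Gamma, uniq A & `|x| - e < \sum_(i <- A) `|x i|.
Proof.
move=> e0.
have := @ub_ereal_sup_adherent _ _ _ e0 (l1_enorm_fin x).
case=> _ [A [finA _] <-].
rewrite -[X in (X - _)%E]l1_normE fsbig_finite// sumEFin -EFinB lte_fin => h.
by exists (finmap.enum_fset (fset_set A)); rewrite ?finmap.fset_uniq.
Qed.

Lemma norm_l1_coord2 x g d : g != d -> `|x g| + `|x d| <= `|x|.
Proof.
move=> gd; have := norm_l1D_unit x (- x d) d; rewrite subrr normr0.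
have := norm_l1_coord (x + - x d *: l1_unit d) g.
by rewrite l1D l1Z l1_unitE (negPf gd) mulr0 addr0; lra.
Qed.

Lemma l1_concentrated x g : `|x| = `|x g| -> x = x g *: l1_unit g.
Proof.
move=> xg; apply: l1P => i; rewrite l1Z l1_unitE.
have [->|ig] := eqVneq i g; first by rewrite mulr1.
rewrite mulr0; apply/normr0_eq0.
have := norm_l1_coord2 x i g ig; have := normr_ge0 (x i).
by move: xg; lra.
Qed.

End l1_coordinates.

(** * Signs of real numbers *)

Lemma normr_eqP (R : realDomainType) (a b : R) :
  `|a| = `|b| -> a = b \/ a = - b.
Proof. by move/eqP; rewrite eqr_norm2 => /orP[] /eqP; [left|right]. Qed.

(** The function [k] below is odd and vanishes only at 0. All data agree up to sign, so either the
    signs match and the claim is immediate, or the hypothesis becomes [|k x - k y| = |k x + k y|],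
    which forces [x = 0] or [y = 0]. *)
Lemma clip_pair (R : realDomainType) (a b x y p q : R) :
  `|q| = `|1 : R| -> `|p| = `|1 : R| -> `|b| = `|y| -> `|a| = `|x| ->
  `| (`|a + p| - `|a - p|) + (`|b + q| - `|b - q|) | =
    `| (`|x + 1| - `|x - 1|) + (`|y + 1| - `|y - 1|) | ->
  a * b = p * q * (x * y).
Proof.
pose k (t : R) := `|t + 1| - `|t - 1|.
have kN t : k (- t) = - k t.
  by rewrite /k opprB; congr (_ - _); rewrite -normrN; congr `|_|; ring.
have k0 t : k t = 0 -> t = 0.
  rewrite /k; case: (ger0P (t + 1)); case: (ger0P (t - 1)) => ? ? ?; lra.
have kM s t : `|s| = `|1 : R| -> `|t + s| - `|t - s| = s * k t.
  move=> /normr_eqP[->|->]; first by rewrite mul1r.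
  by rewrite mulN1r /k opprB opprK.
move=> q1 p1 by_ ax; rewrite !kM//.
case/normr_eqP: p1 => ->; case/normr_eqP: q1 => ->;
case/normr_eqP: by_ => ->; case/normr_eqP: ax => ->;
rewrite -/(k x) -/(k y) ?kN;
case/normr_eqP=> E; try by ring.
all: have /orP[/eqP/k0 ->|/eqP/k0 ->] : (k x == 0) || (k y == 0).
all: try by ring.
all: by apply/orP; (left + right); apply/eqP; lra.
Qed.

(** * Reading a coordinate off the norm *)

Section asymptotic_coordinate.
Context {R : realType} {Y : normedModType R}.
Implicit Types (u y z : Y) (s t : R).

(** The shift length [|y|] will turn out to be large enough for the images of unit vectors, and it
    scales with [y], which makes the formula homogeneous. *)
Definition asymp_coord u y : R :=
  (`|y + `|y| *: u| - `|y - `|y| *: u|) / 2.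

Lemma asymp_coordZ u t y : asymp_coord u (t *: y) = t * asymp_coord u y.
Proof.
rewrite /asymp_coord normrZ.
have [t0|/ltW t0] := ger0P t.
  by rewrite -!scalerA -scalerDr -scalerBr !normrZ ger0_norm//; lra.
have -> : t *: y + (- t * `|y|) *: u = t *: (y - `|y| *: u).
  by rewrite scalerBr scalerA mulNr scaleNr.
have -> : t *: y - (- t * `|y|) *: u = t *: (y + `|y| *: u).
  by rewrite scalerDr scalerA mulNr scaleNr opprK.
by rewrite !normrZ ler0_norm//; lra.
Qed.

Lemma asymp_coord0 u : asymp_coord u 0 = 0.
Proof. by rewrite -(scale0r (0 : Y)) asymp_coordZ mul0r. Qed.

Lemma norm_shift_ninc u y s t : `|u| = 1 -> s <= t ->
  `|y + t *: u| - t <= `|y + s *: u| - s.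
Proof.
move=> u1 st; have -> : y + t *: u = (y + s *: u) + (t - s) *: u.
  by rewrite -addrA -scalerDl subrKC.
have := ler_normD (y + s *: u) ((t - s) *: u).
by rewrite normrZ u1 mulr1 ger0_norm ?subr_ge0//; lra.
Qed.

End asymptotic_coordinate.

Lemma set2_eq (T : Type) (a b c d : T) : [set a; b] = [set c; d] ->
  (a = c /\ b = d) \/ (a = d /\ b = c).
Proof.
move=> E.
have : [set c; d] a by rewrite -E; left.
have : [set c; d] b by rewrite -E; right.
have : [set a; b] c by rewrite E; left.
have : [set a; b] d by rewrite E; right.
by clear E; case=> ? [] ? [] ? [] ?; subst; auto.
Qed.

(** * Direct consequences of the phase condition *)

Section surjective_phase_isometry.
Context {R : realType} {Gamma : choiceType} {Y : normedModType R}.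
Context (f : l1 R Gamma -> Y).
Context (fS : forall y, exists x, f x = y) (fP : phase_isometry f).
Implicit Types (x w : l1 R Gamma) (y z : Y) (g d : Gamma) (s t : R).

Lemma phase_pair x w :
  (`|f x + f w| = `|x + w| /\ `|f x - f w| = `|x - w|) \/
  (`|f x + f w| = `|x - w| /\ `|f x - f w| = `|x + w|).
Proof. exact: set2_eq (fP x w). Qed.

(** The sum, like the absolute difference in [phase_diff], is symmetric in the pair, so it does not
    matter which matching holds. *)
Lemma phase_sum x w :
  `|f x + f w| + `|f x - f w| = `|x + w| + `|x - w|.
Proof. by have [[-> ->]|[-> ->]] := phase_pair x w; rewrite // addrC. Qed.

Lemma phase_diff x w :
  `| `|f x + f w| - `|f x - f w| | = `| `|x + w| - `|x - w| |.
Proof. by have [[-> ->]|[-> ->]] := phase_pair x w; rewrite // distrC. Qed.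

Lemma phase_norm x : `|f x| = `|x|.
Proof.
have dbl (V : normedModType R) (v : V) : `|v + v| = 2 * `|v|.
  by rewrite -mulr2n -scaler_nat normrZ normr_nat.
have := phase_sum x x.
by rewrite !subrr !normr0 !dbl; lra.
Qed.

Lemma phase_eq0 x : f x = 0 -> x = 0.
Proof. by move=> fx; apply/normr0_eq0; rewrite -phase_norm fx normr0. Qed.

(** A preimage [w] of [- f x] satisfies [w + x = 0] or [w - x = 0], since 0 occurs in the pair of
    [w] and [x]. The second case gives [f x = - f x], so [x = 0]. *)
Lemma phaseN x : f (- x) = - f x.
Proof.
have [w fw] := fS (- f x).
have := phase_pair w x; rewrite fw addNr normr0.
case=> -[/esym/normr0_eq0 h _].
  by have -> : - x = w by apply/eqP; rewrite eq_sym -addr_eq0 h.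
have wx : w = x by apply/eqP; rewrite -subr_eq0 h.
have fx0 : f x = 0.
  have : 2 *: f x = 0 by rewrite scaler_nat mulr2n -{1}wx fw addNr.
  by move/eqP; rewrite scaler_eq0 pnatr_eq0/= => /eqP.
have -> : - x = x by rewrite (phase_eq0 x fx0); exact: oppr0.
by rewrite fx0; apply: esym; exact: oppr0.
Qed.

(** Let [z] be a preimage of the left side. Then [|z| = |t * s|], and [phase_sum] against
    [s *: l1_unit g] leaves no room for mass of [z] outside [g]. *)
Lemma phase_scale_unit_le1 g s t : `|t| <= 1 ->
  t *: f (s *: l1_unit g) = f ((t * s) *: l1_unit g) \/
  t *: f (s *: l1_unit g) = - f ((t * s) *: l1_unit g).
Proof.
move=> t1; have [z fz] := fS (t *: f (s *: l1_unit g)).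
have nz : `|z| = `|t * s|.
  by rewrite -phase_norm fz normrZ phase_norm normrZ norm_l1_unit mulr1 normrM.
have tsum : `|t + 1| + `|t - 1| = 2.
  by move: t1; rewrite ler_norml => /andP[? ?];
    rewrite ger0_norm ?ler0_norm; lra.
have := phase_sum z (s *: l1_unit g).
rewrite fz.
have -> : t *: f (s *: l1_unit g) + f (s *: l1_unit g) =
    (t + 1) *: f (s *: l1_unit g) by rewrite scalerDl scale1r.
have -> : t *: f (s *: l1_unit g) - f (s *: l1_unit g) =
    (t - 1) *: f (s *: l1_unit g) by rewrite scalerBl scale1r.
rewrite -scaleNr !norm_l1D_unit !normrZ phase_norm normrZ norm_l1_unit mulr1.
rewrite -mulrDl tsum => E.
have zs : `|z g| <= `|s|.
  apply: le_trans (norm_l1_coord z g) _.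
  by rewrite nz normrM ler_piMl.
have zsum : `|z g + s| + `|z g - s| = 2 * `|s|.
  move: zs; case: (ger0P s) => s0; rewrite ler_norml => /andP[? ?].
    by rewrite ger0_norm ?ler0_norm; lra.
  by rewrite ler0_norm ?ger0_norm; lra.
have zg : `|z| = `|z g| by move: E zsum; lra.
rewrite -fz (l1_concentrated _ _ zg).
have /normr_eqP[->|->] : `|z g| = `|t * s| by rewrite -zg.
  by left.
by right; rewrite scaleNr phaseN.
Qed.

Lemma phase_scale_unit g t :
  f (t *: l1_unit g) = t *: f (l1_unit g) \/
  f (t *: l1_unit g) = - (t *: f (l1_unit g)).
Proof.
have [t1|t1] := leP `|t| 1.
  have := phase_scale_unit_le1 g 1 t t1; rewrite scale1r mulr1.
  by case=> ->; [left|right; rewrite opprK].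
(* For [|t| > 1] the roles are exchanged: the vector [t *: l1_unit g] is shrunk by the factor
   [t^-1]. *)
have t0 : t != 0 by rewrite -normr_gt0; lra.
have it : `|t^-1| <= 1 by rewrite normfV invf_le1 ?ltW// (lt_trans _ t1).
have := phase_scale_unit_le1 g t t^-1 it; rewrite mulVf// scale1r.
case=> E; [left|right].
  by rewrite -E scalerA mulfV// scale1r.
by rewrite -scalerN -E scalerA mulfV// scale1r.
Qed.

Lemma norm_phase_unit g : `|f (l1_unit g)| = 1.
Proof. by rewrite phase_norm norm_l1_unit. Qed.

Lemma phase_shift_sum x g t :
  `|f x + t *: f (l1_unit g)| + `|f x - t *: f (l1_unit g)| =
  2 * (`|x| - `|x g|) + `|x g + t| + `|x g - t|.
Proof.
have := phase_sum x (t *: l1_unit g).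
rewrite -[in x - _]scaleNr !norm_l1D_unit.
by have [->|->] := phase_scale_unit g t; rewrite ?opprK; lra.
Qed.

Lemma phase_shift_diff x g t :
  `| `|f x + t *: f (l1_unit g)| - `|f x - t *: f (l1_unit g)| | =
  `| `|x g + t| - `|x g - t| |.
Proof.
have := phase_diff x (t *: l1_unit g).
rewrite -[in x - _]scaleNr !norm_l1D_unit.
have -> : `|x| - `|x g| + `|x g + t| - (`|x| - `|x g| + `|x g - t|) =
  `|x g + t| - `|x g - t| by lra.
by move=> <-; have [->|->] := phase_scale_unit g t; rewrite ?opprK// distrC.
Qed.

(** * The coordinate functionals on [Y] *)

Let c g y : R := asymp_coord (f (l1_unit g)) y.

(** Each norm minus [s] is nonincreasing in [s], while by [phase_shift_sum] their sum is constant
    for [s >= |y|]; hence each is constant there. *)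
Lemma norm_shift_far g y s : `|y| <= s ->
  `|y + s *: f (l1_unit g)| = `|y + `|y| *: f (l1_unit g)| + (s - `|y|) /\
  `|y - s *: f (l1_unit g)| = `|y - `|y| *: f (l1_unit g)| + (s - `|y|).
Proof.
have [x <-] := fS y => ys.
have far t : `|f x| <= t -> `|x g + t| + `|x g - t| = 2 * t.
  rewrite phase_norm => /(le_trans (norm_l1_coord x g)).
  rewrite ler_norml => /andP[? ?].
  by rewrite ger0_norm ?ler0_norm; lra.
have := far _ ys; have := far _ (lexx _).
have := phase_shift_sum x g s; have := phase_shift_sum x g `|f x|.
have := norm_shift_ninc _ (f x) _ _ (norm_phase_unit g) ys.
have := norm_shift_ninc (- f (l1_unit g)) (f x) _ _ _ ys.
rewrite normrN norm_phase_unit !scalerN => /(_ erefl).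
by split; lra.
Qed.

Lemma asymp_coordE g y s : `|y| <= s ->
  `|y + s *: f (l1_unit g)| - `|y - s *: f (l1_unit g)| = 2 * c g y.
Proof. by move=> /(norm_shift_far g)[-> ->]; rewrite /c /asymp_coord; lra. Qed.

(** At [t = |f x|], which dominates [|x g|], the two sides of [phase_shift_diff] are
    [|2 * c g (f x)|] and [|2 * x g|]. *)
Lemma norm_asymp_coord g x : `|c g (f x)| = `|x g|.
Proof.
have := phase_shift_diff x g `|f x|.
have -> := asymp_coordE g (f x) _ (lexx _).
have := norm_l1_coord x g; rewrite -phase_norm ler_norml => /andP[? ?].
have -> : `|x g + `|f x| | = x g + `|f x| by rewrite ger0_norm; lra.
have -> : `|x g - `|f x| | = `|f x| - x g by rewrite ler0_norm; lra.
have -> : x g + `|f x| - (`|f x| - x g) = 2 * x g by lra.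
by rewrite !normrM normr_nat; lra.
Qed.

Lemma asymp_coordDu g y t :
  c g (y + t *: f (l1_unit g)) = c g y + t.
Proof.
(* With this [s], the shifts by [s], [s + t] and [s - t] used below all lie in the range of
   [norm_shift_far]. *)
pose s := `|y| + `|y + t *: f (l1_unit g)| + `|t|.
have t1 := ler_norm t; have t2 := ler_norm (- t); rewrite normrN in t2.
have n1 := normr_ge0 y; have n2 := normr_ge0 (y + t *: f (l1_unit g)).
have h1 : `|y + t *: f (l1_unit g)| <= s by rewrite /s; lra.
have h2 : `|y| <= s + t by rewrite /s; lra.
have h3 : `|y| <= s - t by rewrite /s; lra.
have := asymp_coordE g _ _ h1.
have -> : y + t *: f (l1_unit g) + s *: f (l1_unit g) =
  y + (s + t) *: f (l1_unit g) by rewrite -addrA -scalerDl (addrC t).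
have -> : y + t *: f (l1_unit g) - s *: f (l1_unit g) =
  y - (s - t) *: f (l1_unit g) by rewrite -addrA -scalerBl -scaleNr opprB.
have [-> _] := norm_shift_far g _ _ h2.
have [_ ->] := norm_shift_far g _ _ h3.
by have := asymp_coordE g y _ (lexx _); lra.
Qed.

Lemma asymp_coord_lip g y z : `|c g y - c g z| <= `|y - z|.
Proof.
pose s := `|y| + `|z|.
have n1 := normr_ge0 y; have n2 := normr_ge0 z.
have h1 : `|y| <= s by rewrite /s; lra.
have h2 : `|z| <= s by rewrite /s; lra.
have e1 := asymp_coordE g _ _ h1; have e2 := asymp_coordE g _ _ h2.
have shift v : `| `|y + v| - `|z + v| | <= `|y - z|.
  have <- : y + v - (z + v) = y - z by rewrite opprD addrACA subrr addr0.
  exact: ler_dist_dist.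
have := shift (s *: f (l1_unit g)); have := shift (- (s *: f (l1_unit g))).
rewrite !ler_norml => /andP[? ?] /andP[? ?].
by apply/andP; split; lra.
Qed.

(** For preimages [x] of [y] and [w] of the shifted point, [w - x] or [w + x] has norm [|t|]. By
    hypothesis its coordinate at [d] already uses up this norm, so its coordinate at [g]
    vanishes. *)
Lemma norm_asymp_coord_step g d y t : g != d ->
  `| `|c d y + t| - `|c d y| | = `|t| ->
  `|c g (y + t *: f (l1_unit d))| = `|c g y|.
Proof.
move=> gd; have [x <-] := fS y.
have [w fw] := fS (f x + t *: f (l1_unit d)).
rewrite -asymp_coordDu -fw !norm_asymp_coord => wt.
have nt : `|f w - f x| = `|t|.
  by rewrite fw addrC addrA addNr add0r normrZ norm_phase_unit mulr1.
have coord0 (v : l1 R Gamma) : `|v| = `|t| -> `|t| <= `|v d| -> v g = 0.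
  move=> vt tv; apply/normr0_eq0; have := norm_l1_coord2 v g d gd.
  by have := normr_ge0 (v g); lra.
have [[_ h]|[_ h]] := phase_pair w x; rewrite nt in h.
  have : (w - x) g = 0.
    by apply: coord0 => //; rewrite -wt; exact: ler_dist_dist.
  by rewrite l1D l1N => /subr0_eq ->.
have : (w + x) g = 0.
  apply: coord0 => //; rewrite -wt l1D -(normrN (x d)) -[x d in leRHS]opprK.
  exact: ler_dist_dist.
by rewrite l1D => /eqP; rewrite addr_eq0 => /eqP ->; rewrite normrN.
Qed.

(* Going from [a] to [a + t] through [0] makes both steps monotone in
   absolute value, as [norm_asymp_coord_step] requires. *)
Lemma norm_asymp_coordDu_neq g d y t : g != d ->
  `|c g (y + t *: f (l1_unit d))| = `|c g y|.
Proof.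
move=> gd; pose a := c d y.
have -> : y + t *: f (l1_unit d) =
    (y + (- a) *: f (l1_unit d)) + (t + a) *: f (l1_unit d).
  by rewrite -addrA -scalerDl addrCA addNr addr0.
rewrite norm_asymp_coord_step//.
  by rewrite norm_asymp_coord_step// -/a subrr normr0 sub0r !normrN normr_id.
by rewrite asymp_coordDu -/a subrr add0r normr0 subr0 normr_id.
Qed.

(** The equality of absolute values persists after adding [s *: f (l1_unit g)], which translates
    both coordinates by [s]; [s = - q] removes the sign ambiguity. *)
Lemma asymp_coordDu_neq g d y t : g != d ->
  c g (y + t *: f (l1_unit d)) = c g y.
Proof.
move=> gd; set p := c g _; set q := c g y.
have pq s : `|p + s| = `|q + s|.
  rewrite -!asymp_coordDu addrAC.
  exact: norm_asymp_coordDu_neq.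
have := pq (- q); rewrite subrr normr0 => /normr0_eq0.
by move/subr0_eq.
Qed.

(** * Finite combinations, density and additivity *)

Lemma asymp_coordD_sum g z (A : seq Gamma) (a : Gamma -> R) : uniq A ->
  c g (z + \sum_(i <- A) a i *: f (l1_unit i)) =
  c g z + (if g \in A then a g else 0).
Proof.
elim: A z => [|i A IH] z /=; first by rewrite big_nil !addr0.
case/andP=> iA uA; rewrite big_cons addrA IH// inE.
have [->|gi] := eqVneq g i; first by rewrite (negPf iA) asymp_coordDu addr0.
by rewrite asymp_coordDu_neq.
Qed.

Lemma finite_approx g0 y (e : R) : 0 < e ->
  exists (A : seq Gamma) (a : Gamma -> R),
    uniq A /\ `|y - \sum_(i <- A) a i *: f (l1_unit i)| < e.
Proof.
move=> e0; have [x <-] := fS y.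
have [A uA Ae] := norm_l1_partial_sum x e e0.
(* [A] carries all but [e] of the norm of [x]. Subtracting the coordinates of [f x] in [A] leaves a
   point whose preimage vanishes on [A] and agrees with [x] in absolute value elsewhere. *)
exists A, (fun i => c i (f x)); split => //.
have [w fw] := fS (f x - \sum_(i <- A) c i (f x) *: f (l1_unit i)).
have cw i : c i (f w) = c i (f x) - (if i \in A then c i (f x) else 0).
  rewrite fw -sumrN; under eq_bigr do rewrite -scaleNr.
  by rewrite asymp_coordD_sum//; case: ifP => _; rewrite ?oppr0.
rewrite -fw phase_norm.
have : `|w| + \sum_(i <- A) `|x i| = `|x|.
  apply: (norm_l1_vanish g0) => // [i iA|i /negPf iA].
    by apply/normr0_eq0; rewrite -norm_asymp_coord cw iA subrr normr0.
  by rewrite -!norm_asymp_coord cw iA subr0.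
by move: Ae; lra.
Qed.

(** Additivity is exact when [z] is replaced by a finite combination [v]; the Lipschitz bound
    controls the two errors by [e / 2] each. *)
Lemma asymp_coordD g y z : c g (y + z) = c g y + c g z.
Proof.
apply/eqP; rewrite -subr_eq0 -normr_le0; apply/ler_addgt0Pl => e e0.
have e2 : 0 < e / 2 by lra.
have [A [a [uA]]] := finite_approx g z _ e2.
set v := \sum_(i <- A) _ => zv; rewrite addr0.
have := asymp_coord_lip g (y + z) (y + v).
have -> : y + z - (y + v) = z - v by rewrite opprD addrACA subrr add0r.
have := asymp_coord_lip g z v.
have : c g v = if g \in A then a g else 0.
  by rewrite -[v]add0r asymp_coordD_sum// [c g 0]asymp_coord0 add0r.
rewrite {2}/v asymp_coordD_sum// => <-.
move=> /le_lt_trans/(_ zv); rewrite ltr_norml => /andP[? ?].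
move=> /le_lt_trans/(_ zv); rewrite ltr_norml => /andP[? ?].
by rewrite ler_norml; apply/andP; split; lra.
Qed.

(** * Separation of points and the choice of signs *)

Lemma asymp_coord_eq0 g0 y : (forall g, c g y = 0) -> y = 0.
Proof.
have [x <-] := fS y => cx0.
apply/normr0_eq0; rewrite phase_norm.
rewrite (norm_l1_eq g0 0) ?normr0// => g.
by rewrite -norm_asymp_coord cx0.
Qed.

Lemma norm_asymp_coord_eq2 g d y x : g != d ->
  (forall i, i != g -> i != d -> `|c i y| = `|x i|) ->
  `|y| = `|x| - `|x g| - `|x d| + `|c g y| + `|c d y|.
Proof.
have [w <-] := fS y => gd h.
have := norm_l1_eq2 _ _ w x gd.
rewrite phase_norm !norm_asymp_coord => /(_ _)/wrap[i ig id|].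
  by rewrite -norm_asymp_coord h.
by lra.
Qed.

(** Test the phase condition against [z = l1_unit g + l1_unit d]: in the difference of the two norms
    everything outside [g] and [d] cancels, which leaves the situation of [clip_pair]. *)
Lemma asymp_coord_pair g d : g != d -> exists2 r : R, `|r| = 1 & forall x,
  c g (f x) * c d (f x) = r * (x g * x d).
Proof.
move=> gd; pose z := l1_unit g + l1_unit d : l1 R Gamma.
have zg : z g = 1 by rewrite l1D !l1_unitE eqxx (negPf gd) addr0.
have zd : z d = 1 by rewrite l1D !l1_unitE eqxx eq_sym (negPf gd) add0r.
have z0 i : i != g -> i != d -> z i = 0.
  by move=> /negPf ig /negPf id; rewrite l1D !l1_unitE ig id addr0.
have cz0 i : i != g -> i != d -> c i (f z) = 0.
  by move=> ig id; apply/normr0_eq0; rewrite norm_asymp_coord z0 ?normr0.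
set p := c g (f z); set q := c d (f z); exists (p * q) => [|x].
  by rewrite normrM /p /q !norm_asymp_coord zg zd normr1 mul1r.
have cN i y : c i (- y) = - c i y.
  by rewrite -scaleN1r [c _ _]asymp_coordZ mulN1r.
have h1 : `|f x + f z| =
    `|x| - `|x g| - `|x d| + `|c g (f x) + p| + `|c d (f x) + q|.
  rewrite -!asymp_coordD; apply: norm_asymp_coord_eq2 => // i ig id.
  by rewrite asymp_coordD cz0// addr0 norm_asymp_coord.
have h2 : `|f x - f z| =
    `|x| - `|x g| - `|x d| + `|c g (f x) - p| + `|c d (f x) - q|.
  rewrite -!cN -!asymp_coordD; apply: norm_asymp_coord_eq2 => // i ig id.
  by rewrite asymp_coordD cN cz0// subr0 norm_asymp_coord.
have h3 : `|x + z| - `|x g + 1| - `|x d + 1| = `|x| - `|x g| - `|x d|.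
  rewrite -{1}zg -zd -!l1D; apply: norm_l1_eq2 => // i ig id.
  by rewrite l1D z0// addr0.
have h4 : `|x - z| - `|x g - 1| - `|x d - 1| = `|x| - `|x g| - `|x d|.
  rewrite -{1}zg -zd -!l1N -!l1D; apply: norm_l1_eq2 => // i ig id.
  by rewrite l1D l1N z0// subr0.
have := phase_diff x z; rewrite h1 h2.
have -> : `|x + z| - `|x - z| =
   (`|x g + 1| - `|x g - 1|) + (`|x d + 1| - `|x d - 1|) by lra.
have := norm_asymp_coord g x; have := norm_asymp_coord d x.
have := norm_asymp_coord g z; have := norm_asymp_coord d z.
rewrite zg zd -/p -/q.
set a := c g _; set b := c d _.
have -> (n : R) : n + `|a + p| + `|b + q| - (n + `|a - p| + `|b - q|) =
  (`|a + p| - `|a - p|) + (`|b + q| - `|b - q|) by lra.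
exact: clip_pair.
Qed.

Lemma asymp_coord_signs g0 : exists2 th : Gamma -> R, (forall g, `|th g| = 1) &
  forall x g d, c g (f x) * c d (f x) = th g * th d * (x g * x d).
Proof.
have sq x g : c g (f x) * c g (f x) = x g * x g.
  rewrite -!expr2 -[LHS]real_normK ?num_real// norm_asymp_coord.
  by rewrite real_normK ?num_real.
have pair g d : exists r : R, `|r| = 1 /\ forall x,
    c g (f x) * c d (f x) = r * (x g * x d).
  have [->|gd] := eqVneq g d.
    by exists 1; split=> [|x]; rewrite ?normr1 ?mul1r.
  by have [r r1 rE] := asymp_coord_pair g d gd; exists r.
(* [th g] is the sign attached to the pair of [g0] and [g]. *)
have [th thP] := choice (pair g0).
exists th => [g|x g d]; first by have [] := thP g.
have [r [_ rE]] := pair g d; rewrite rE; congr (_ * _).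
(* A point with nonzero coordinates at [g], [d] and [g0], even if these coincide, lets the sign
   identity be checked by cancellation. *)
pose v := l1_unit g + l1_unit d + l1_unit g0 : l1 R Gamma.
have vE i : v i = (i == g)%:R + (i == d)%:R + (i == g0)%:R by [].
have v_gt0 i : [|| i == g, i == d | i == g0] -> 0 < v i.
  by rewrite vE; case: (i == g); case: (i == d); case: (i == g0) => //= _; lra.
have vg : v g != 0 by rewrite gt_eqF// v_gt0// eqxx.
have vd : v d != 0 by rewrite gt_eqF// v_gt0// eqxx orbT.
have v0 : v g0 != 0 by rewrite gt_eqF// v_gt0// eqxx !orbT.
have [_ /(_ v) Eg] := thP g; have [_ /(_ v) Ed] := thP d.
have {}rE := rE v; have s0 := sq v g0.
have nz : v g0 * v g0 * (v g * v d) != 0 by rewrite !mulf_neq0.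
apply: (mulIf nz).
rewrite mulrCA -rE -s0.
transitivity (c g0 (f v) * c g (f v) * (c g0 (f v) * c d (f v))); first by ring.
by rewrite Eg Ed s0; ring.
Qed.

(** The sign [e] is read off at one [g] with [x g != 0]; the product formula then carries it to
    every other index. *)
Lemma asymp_coord_phase g0 : exists2 th : Gamma -> R, (forall g, `|th g| = 1) &
  forall x, exists e : R, (e = -1 \/ e = 1) /\
    forall g, c g (f x) = e * (th g * x g).
Proof.
have [th th1 thP] := asymp_coord_signs g0; exists th => // x.
have th2 g : th g * th g = 1.
  by rewrite -expr2 -real_normK ?num_real// th1 expr1n.
have [[g xg]|x0] := pselect (exists g, x g != 0); last first.
  exists 1; split; first by right.
  move=> g; have xg : x g = 0.
    by apply/eqP/negPn/negP => xg; apply: x0; exists g.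
  rewrite xg !mulr0; apply: normr0_eq0.
  by rewrite norm_asymp_coord xg normr0.
have /normr_eqP h : `|c g (f x)| = `|th g * x g|.
  by rewrite norm_asymp_coord normrM th1 mul1r.
have key e : e * e = 1 -> c g (f x) = e * (th g * x g) ->
    forall d, c d (f x) = e * (th d * x d).
  move=> ee cg d.
  have nz : th g * x g != 0 by rewrite -normr_eq0 normrM th1 mul1r normr_eq0.
  apply: (mulfI nz); have := thP x g d; rewrite cg => E.
  have -> : th g * x g * c d (f x) = e * e * (th g * x g * c d (f x)).
    by rewrite ee mul1r.
  have -> : e * e * (th g * x g * c d (f x)) =
    e * (e * (th g * x g) * c d (f x)) by ring.
  by rewrite E; ring.
by case: h => h; [exists 1|exists (-1)]; split;
  rewrite ?mul1r; [by right| apply: key; rewrite ?mul1r |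
    by left | apply: key; rewrite ?mulN1r ?opprK].
Qed.

(** The coordinates of [G x] are [th g * x g], hence linear in [x], and coordinates separate points
    of [Y]. Norm preservation of [f] then makes the linear map [G] an isometry. *)
Lemma phase_equivalent g0 : phase_equivalent_to_linear_isometry f.
Proof.
have [th th1 /choice[eps epsP]] := asymp_coord_phase g0.
pose G x := eps x *: f x.
have cG g x : c g (G x) = th g * x g.
  have [e1 E] := epsP x; rewrite [LHS]asymp_coordZ [X in _ * X]E mulrA.
  by case: e1 => ->; rewrite ?mulrNN !mul1r.
have coord_inj y z : (forall g, c g y = c g z) -> y = z.
  move=> yz; apply/subr0_eq/(asymp_coord_eq0 g0) => g.
  by rewrite asymp_coordD -scaleN1r [X in _ + X]asymp_coordZ mulN1r yz subrr.
have Glin : linear G.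
  move=> a x y; apply: coord_inj => g.
  rewrite asymp_coordD [X in _ = X + _]asymp_coordZ.
  rewrite -[asymp_coord _ _]/(c g (G x)) !cG l1D l1Z.
  by ring.
exists eps; split; first by move=> x; have [] := epsP x.
split=> // x y; rewrite -/(G x) -/(G y).
have -> : G x - G y = G (x - y).
  by rewrite addrC -scaleN1r -Glin scaleN1r addrC.
rewrite /G normrZ phase_norm.
by have [[->|->] _] := epsP (x - y); rewrite ?normrN normr1 mul1r.
Qed.

End surjective_phase_isometry.

Theorem theorem3p6 (R : realType) (Gamma : choiceType) (Y : normedModType R)
    (f : l1 R Gamma -> Y) :
  [set: Gamma] !=set0 ->
  set_surj [set: l1 R Gamma] [set: Y] f ->
  phase_isometry f ->
  phase_equivalent_to_linear_isometry f.
Proof.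
move=> [g0 _] fS fP; apply: phase_equivalent => // y.
by have [x _ <-] := fS y I; exists x.
Qed.
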